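(* Let $A$ be a von Neumann algebra and $F$ a JB$^*$-triple. Then every (not necessarily linear) 2-local triple homomorphism $T:A\to F$ is linear and a triple homomorphism.
   Context: A JB$^*$-triple is a complex Banach space $E$ with a continuous triple product $\{.,.,.\}:E\times E\times E\to E$, conjugate-linear in the middle variable and symmetric and bilinear in the outer variables, such that, writing $L(a,b)x=\{a,b,x\}$, for all $a,b,x,y\in E$: (1) $L(a,b)L(x,y)-L(x,y)L(a,b)=L(L(a,b)x,y)-L(x,L(b,a)y)$; (2) $L(a,a)$ is a hermitian operator with non-negative spectrum; (3) $\|\{a,a,a\}\|=\|a\|^3$. Every C$^*$-algebra (in particular every von Neumann algebra) is regarded as a JB$^*$-triple with the triple product $\{a,b,c\}:=\frac12(ab^*c+cb^*a)$. A triple homomorphism between JB$^*$-triples is a linear map $\Phi:E\to F$ with $\Phi(\{a,b,c\})=\{\Phi(a),\Phi(b),\Phi(c)\}$ for all $a,b,c\in E$. A mapping $T:E\to F$ (not assumed linear or continuous) is a 2-local triple homomorphism if for every $a,b\in E$ there is a bounded (linear) triple homomorphism $\Phi_{a,b}:E\to F$, depending on $a,b$, with $\Phi_{a,b}(a)=T(a)$ and $\Phi_{a,b}(b)=T(b)$. *)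

(* Defs.v *)
From HB Require Import structures.
From mathcomp Require Import all_boot all_order all_algebra.
From mathcomp Require Import complex.
From mathcomp Require Import all_classical all_reals all_analysis.

Set Implicit Arguments.
Unset Strict Implicit.
Unset Printing Implicit Defensive.

Import Order.TTheory GRing.Theory Num.Theory.
Import numFieldNormedType.Exports.

Local Open Scope classical_set_scope.
Local Open Scope ring_scope.
Local Open Scope complex_scope.

Definition bounded_linear (K : numFieldType) (V W : normedModType K)
    (f : V -> W) : Prop :=
  linear f /\ exists c : K, forall x, `|f x| <= c * `|x|.

Section Operators.
Variables (R : realType) (E : normedModType R[i]).
Implicit Type S : E -> E.

(* The spectrum of S as an element of the Banach algebra of bounded linear
   operators on E. *)
Definition spectrum S : set R[i] :=
  [set l | ~ exists U : E -> E,
     [/\ bounded_linear U, cancel (fun x => S x - l *: x) U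
       & cancel U (fun x => S x - l *: x)]].

(* exp (z S) x, as the norm limit of the partial sums of the exponential
   series; they converge whenever S is bounded and E is complete. *)
Definition exp_op (z : R[i]) S (x : E) : E :=
  limn (fun n => \sum_(0 <= k < n) (z ^+ k / k`!%:R) *: iter k S x).

(* S is hermitian: exp (i t S) is an isometry for every real t. *)
Definition hermitian_op S : Prop :=
  bounded_linear S /\
  forall (t : R) (x : E), `|exp_op ('i * t%:C) S x| = `|x|.

End Operators.

(* Normed spaces with a bare ternary operation; both the JB*-triples and the
   von Neumann algebras below are instances. *)
HB.mixin Record hasTriple (R : realType) E of NormedModule R[i] E := {
  triple : E -> E -> E -> E
}.

#[short(type="tripleModType")]
HB.structure Definition TripleModule (R : realType) :=
  {E of hasTriple R E & NormedModule R[i] E}.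

(* In tripleL, L(a, b) is triple a b. *)
HB.mixin Record TripleModule_isJBTriple (R : realType) E
    of TripleModule R E := {
  triple_continuous :
    continuous (fun p : E * E * E => triple p.1.1 p.1.2 p.2);
  triple_linear : forall b c : E, linear (fun a => triple a b c);
  triple_sym : forall a b c : E, triple a b c = triple c b a;
  triple_antilinear : forall (a c : E) (k : R[i]) (b b' : E),
    triple a (k *: b + b') c = k^* *: triple a b c + triple a b' c;
  tripleL : forall a b x y z : E,
    triple a b (triple x y z) - triple x y (triple a b z) =
    triple (triple a b x) y z - triple x (triple b a y) z;
  triple_hermitian : forall a : E, hermitian_op (triple a a);
  triple_spectrum_ge0 : forall (a : E) (l : R[i]),
    spectrum (triple a a) l -> 0 <= l;
  triple_norm : forall a : E, `|triple a a a| = `|a| ^+ 3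
}.

#[short(type="jbTripleType")]
HB.structure Definition JBTriple (R : realType) :=
  {E of TripleModule_isJBTriple R E & TripleModule R E
      & CompleteNormedModule R[i] E}.

Definition triple_homomorphism (R : realType) (E F : tripleModType R)
    (f : E -> F) : Prop :=
  linear f /\ forall a b c, f (triple a b c) = triple (f a) (f b) (f c).

Definition two_local_triple_homomorphism (R : realType)
    (E F : tripleModType R) (T : E -> F) : Prop :=
  forall a b : E, exists f : E -> F,
    [/\ triple_homomorphism f, bounded_linear f, f a = T a & f b = T b].

HB.mixin Record NormedModule_isHilbert (R : realType) H
    of NormedModule R[i] H := {
  inner : H -> H -> R[i];
  inner_linear : forall (k : R[i]) (x y z : H),
    inner (k *: x + y) z = k * inner x z + inner y z;
  inner_conj : forall x y : H, inner y x = (inner x y)^*;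
  inner_norm : forall x : H, inner x x = `|x| ^+ 2
}.

#[short(type="hilbertType")]
HB.structure Definition Hilbert (R : realType) :=
  {H of NormedModule_isHilbert R H & CompleteNormedModule R[i] H}.

Section VonNeumannAlgebras.
Variables (R : realType) (H : hilbertType R).
Implicit Types (a b : H -> H) (M : set (H -> H)).

Definition is_adjoint a b : Prop :=
  forall x y : H, inner (a x) y = inner x (b y).

(* The commutant inside the algebra B(H) of bounded linear operators. *)
Definition commutant M : set (H -> H) :=
  [set b | bounded_linear b /\ forall a, M a -> a \o b = b \o a].

(* A von Neumann algebra on H: a self-adjoint set of bounded operators which
   equals its bicommutant. It is then automatically a unital *-subalgebra of
   B(H), and closed in the weak operator topology. *)
Record vonNeumannAlgebra := VonNeumannAlgebra {
  vN_set : set (H -> H);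
  vN_selfadjoint : forall a, vN_set a -> exists2 b, vN_set b & is_adjoint a b;
  vN_bicommutant : commutant (commutant vN_set) = vN_set
}.

(* The operator norm; the norms of complex normed spaces take their values in
   the nonnegative real elements of R[i]. *)
Definition opnorm a : R[i] :=
  (sup [set complex.Re `|a x| | x in [set x : H | `|x| <= 1]])%:C.

End VonNeumannAlgebras.

Section BoundedOperators.
Variable (R : realType).
Local Notation C := R[i].

Lemma Re_normK (V : normedModType C) (x : V) : (complex.Re `|x|)%:C = `|x|.
Proof.
have /complex_realP[k ->] : `|x| \is Num.real by exact: normr_real.
by [].
Qed.

Lemma Re_norm_ge0 (V : normedModType C) (x : V) : 0 <= complex.Re `|x|.
Proof. by rewrite -lecR Re_normK; exact: normr_ge0. Qed.

Lemma bounded_linear_nneg (V W : normedModType C) (f : V -> W) :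
  bounded_linear f -> exists2 c : R, 0 <= c & forall x, `|f x| <= c%:C * `|x|.
Proof.
move=> [_ [c fc]]; exists (Num.max 0 (complex.Re c)).
  by rewrite le_max lexx.
move=> x; have [->|x0] := eqVneq x 0.
  by move: (fc 0); rewrite normr0 !mulr0.
have nx : 0 < `|x| by rewrite normr_gt0.
have c0 : 0 <= c by rewrite -(pmulr_lge0 _ nx) (le_trans _ (fc x)).
rewrite (le_trans (fc x))// ler_wpM2r//.
move: c0; rewrite !lecE /= => /andP[/eqP Ic Rc].
by rewrite -Ic eqxx /= le_max lexx orbT.
Qed.

Section normed.
Variables (V W : normedModType C).
Implicit Types f g : V -> W.

Lemma bounded_linear0 : bounded_linear (0 : V -> W).
Proof.
split; first by move=> k x y; rewrite /= /GRing.zero /= scaler0 addr0.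
by exists 0 => x; rewrite mul0r normr0.
Qed.

Lemma bounded_linearD f g :
  bounded_linear f -> bounded_linear g -> bounded_linear (f + g).
Proof.
move=> [lf [c fc]] [lg [d gd]]; split.
  by move=> k x y; rewrite !addrfctE lf lg scalerDr addrACA.
by exists (c + d) => x; rewrite mulrDl (le_trans (ler_normD _ _))// lerD.
Qed.

Lemma bounded_linearZ k f : bounded_linear f -> bounded_linear (k *: f).
Proof.
move=> [lf [c fc]]; split.
  move=> l x y; rewrite !scalrfctE lf scalerDr !scalerA.
  by rewrite [k * l]mulrC.
by exists (`|k| * c) => x; rewrite normrZ -mulrA ler_wpM2l.
Qed.

End normed.

Lemma bounded_linear_comp (U V W : normedModType C) (f : V -> W) (g : U -> V) :
  bounded_linear f -> bounded_linear g -> bounded_linear (f \o g).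
Proof.
move=> bf bg; split.
  by move=> k x y /=; rewrite bg.1 bf.1.
have [c c0 fc] := bounded_linear_nneg bf.
have [d d0 gd] := bounded_linear_nneg bg.
exists (c%:C * d%:C) => x /=; rewrite (le_trans (fc _))// -mulrA ler_wpM2l//.
by rewrite lecE /= eqxx.
Qed.

Section opnorm.
Variable H : hilbertType R.
Implicit Types a b : H -> H.

Let ball_image a := [set complex.Re `|a x| | x in [set x : H | `|x| <= 1]].

Lemma bounded_linear_has_sup a : bounded_linear a -> has_sup (ball_image a).
Proof.
move=> ba; have [c c0 ac] := bounded_linear_nneg ba; split.
  by exists (complex.Re `|a 0|), 0; rewrite /= ?normr0 ?ler01.
exists c => _ [x /= x1 <-]; rewrite -lecR Re_normK (le_trans (ac x))//.
by rewrite ler_piMr// lecE /= eqxx.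
Qed.

Lemma opnorm_ub a x : bounded_linear a -> `|a x| <= opnorm a * `|x|.
Proof.
move=> ba; have [x0|x0] := eqVneq x 0.
  have [_ [c ac]] := ba.
  by have := ac x; rewrite x0 normr0 !mulr0.
have nx : 0 < `|x| by rewrite normr_gt0.
have a0 : linear a by have [] := ba.
have aZ k y : a (k *: y) = k *: a y.
  have a00 : a 0 = 0.
    by have := a0 (-1) 0 0; rewrite scaler0 addr0 scaleN1r addNr.
  by have := a0 k y 0; rewrite addr0 a00 addr0.
have : `|a (`|x|^-1 *: x)| <= opnorm a.
  rewrite -Re_normK lecR; apply: ub_le_sup.
    by have [] := bounded_linear_has_sup ba.
  exists (`|x|^-1 *: x) => //=.
  by rewrite normrZ normfV normr_id mulVf// gt_eqF.
by rewrite aZ normrZ normfV normr_id mulrC ler_pdivrMr.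
Qed.

Lemma opnorm_le a (c : R) : 0 <= c ->
  (forall x, `|a x| <= c%:C * `|x|) -> opnorm a <= c%:C.
Proof.
move=> c0 ac; rewrite lecR; apply: ge_sup.
  by exists (complex.Re `|a 0|), 0; rewrite /= ?normr0 ?ler01.
move=> _ [x /= x1 <-]; rewrite -lecR Re_normK (le_trans (ac x))//.
by rewrite ler_piMr// lecE /= eqxx.
Qed.

Lemma opnorm_ge0 a : bounded_linear a -> 0 <= opnorm a.
Proof.
move=> ba; rewrite lecR; apply: (@le_trans _ _ (complex.Re `|a 0|)).
  exact: Re_norm_ge0.
apply: ub_le_sup; first by have [] := bounded_linear_has_sup ba.
by exists 0; rewrite /= ?normr0 ?ler01.
Qed.

Lemma opnorm_real a : exists r : R, opnorm a = r%:C.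
Proof. by eexists. Qed.

Lemma opnormD a b : bounded_linear a -> bounded_linear b ->
  opnorm (a + b) <= opnorm a + opnorm b.
Proof.
move=> ba bb.
have := opnorm_ge0 ba; have := opnorm_ge0 bb.
have [[r Er] [s Es]] := (opnorm_real a, opnorm_real b).
rewrite Er Es !lecR => s0 r0; rewrite -rmorphD.
apply: opnorm_le; first exact: addr_ge0.
move=> x; rewrite rmorphD mulrDl (le_trans (ler_normD _ _))//.
have := opnorm_ub x ba; have := opnorm_ub x bb; rewrite Er Es => bx ax.
exact: lerD ax bx.
Qed.

Lemma opnormZ_le k a : bounded_linear a ->
  opnorm (k *: a) <= `|k| * opnorm a.
Proof.
move=> ba; have := opnorm_ge0 ba; have [r Er] := opnorm_real a.
have /complex_realP[t Et] : `|k| \is Num.real by exact: normr_real.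
have t0 : 0 <= t by rewrite -lecR -Et; exact: normr_ge0.
rewrite Er lecR => r0; rewrite Et -rmorphM; apply: opnorm_le.
  exact: mulr_ge0.
move=> x; rewrite rmorphM -mulrA normrZ Et; apply: ler_wpM2l.
  by rewrite lecR.
by have := opnorm_ub x ba; rewrite Er.
Qed.

Lemma opnormZ k a : bounded_linear a -> opnorm (k *: a) = `|k| * opnorm a.
Proof.
move=> ba; apply/eqP; rewrite eq_le opnormZ_le//=.
have [->|k0] := eqVneq k 0.
  by rewrite normr0 mul0r opnorm_ge0//; exact: bounded_linearZ.
have {1}-> : a = k^-1 *: (k *: a) by rewrite scalerA mulVf// scale1r.
rewrite mulrC -ler_pdivlMr ?normr_gt0// mulrC -normfV opnormZ_le//.
exact: bounded_linearZ.
Qed.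

Lemma opnorm0_eq0 a : bounded_linear a -> opnorm a = 0 -> a = 0.
Proof.
move=> ba a0; apply/funext => x; apply/eqP; rewrite -normr_le0.
by rewrite (le_trans (opnorm_ub x ba))// a0 mul0r.
Qed.

End opnorm.
End BoundedOperators.

Section VonNeumannTheory.
Variables (R : realType) (H : hilbertType R) (A : vonNeumannAlgebra H).
Local Notation M := (vN_set A).

Lemma vN_bicommutantP a : M a <-> commutant (commutant M) a.
Proof. by rewrite vN_bicommutant. Qed.

Lemma vN_bounded a : M a -> bounded_linear a.
Proof. by move=> /vN_bicommutantP[]. Qed.

Lemma vN_comp a b : M a -> M b -> M (a \o b).
Proof.
move=> /vN_bicommutantP[ba ca] /vN_bicommutantP[bb cb].
apply/vN_bicommutantP; split; first exact: bounded_linear_comp.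
by move=> c cc; rewrite compA (ca _ cc) -compA (cb _ cc).
Qed.

Lemma vN_subsemimod : subsemimod_closed [in M].
Proof.
split; first split.
- rewrite /= inE; apply/vN_bicommutantP; split; first exact: bounded_linear0.
  move=> c [[lc _] _]; apply/funext => x /=.
  have := lc (-1) 0 0; rewrite scaler0 addr0 => c0.
  by rewrite -[LHS](_ : c 0 = _)// c0 scaleN1r addNr.
- move=> a b; rewrite /= !inE => /vN_bicommutantP[ba ca] /vN_bicommutantP[bb cb].
  apply/vN_bicommutantP; split; first exact: bounded_linearD.
  move=> c cc; apply/funext => x.
  have lc : linear c by case: cc => -[].
  have := lc 1 (a x) (b x); rewrite !scale1r => /= cD.
  rewrite [LHS](_ : _ = c (a x + b x))// cD.
  by have /(congr1 (@^~ x)) /= -> := ca _ cc; have /(congr1 (@^~ x)) /= -> := cb _ cc.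
- move=> k a; rewrite /= !inE => /vN_bicommutantP[ba ca].
  apply/vN_bicommutantP; split; first exact: bounded_linearZ.
  move=> c cc; apply/funext => x.
  have lc : linear c by case: cc => -[].
  have c0 : c 0 = 0.
    by have := lc (-1) 0 0; rewrite scaler0 addr0 scaleN1r addNr.
  have := lc k (a x) 0; rewrite c0 !addr0 => /= cZ.
  rewrite [LHS](_ : _ = c (k *: a x))// cZ.
  by have /(congr1 (@^~ x)) /= -> := ca _ cc.
Qed.

(* The elements of A, with the vector space structure and the operator norm
   inherited from B(H). *)
Definition vN_elt := {a : H -> H | a \in M}.

HB.instance Definition _ := [isSub of vN_elt for @sval _ _].
HB.instance Definition _ := [Choice of vN_elt by <:].
HB.instance Definition _ :=
  GRing.SubChoice_isSubLmodule.Build R[i] (H -> H) [in M] vN_elt vN_subsemimod.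

Implicit Types a b c : vN_elt.

Lemma vN_valP a : M (val a).
Proof. by have := valP a; rewrite /= inE. Qed.

Definition vN_norm a : R[i] := opnorm (val a).

Lemma vN_normD a b : vN_norm (a + b) <= vN_norm a + vN_norm b.
Proof. by rewrite /vN_norm raddfD opnormD//; apply/vN_bounded/vN_valP. Qed.

Lemma vN_normZ (k : R[i]) a : vN_norm (k *: a) = `|k| * vN_norm a.
Proof. by rewrite /vN_norm linearZ opnormZ//; apply/vN_bounded/vN_valP. Qed.

Lemma vN_norm0_eq0 a : vN_norm a = 0 -> a = 0.
Proof.
move=> /opnorm0_eq0 a0; apply: val_inj; rewrite raddf0.
by apply: a0; apply/vN_bounded/vN_valP.
Qed.

HB.instance Definition _ :=
  Lmodule_isNormed.Build R[i] vN_elt vN_normD vN_normZ vN_norm0_eq0.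

Definition vN_mul a b : vN_elt :=
  exist _ (val a \o val b) (mem_set (vN_comp (vN_valP a) (vN_valP b))).

Definition vN_star a : vN_elt :=
  let b := cid2 (vN_selfadjoint (vN_valP a)) in
  exist _ (s2val b) (mem_set (s2valP b)).

Lemma vN_starP a : is_adjoint (val a) (val (vN_star a)).
Proof. exact: s2valP' (cid2 (vN_selfadjoint (vN_valP a))). Qed.

Definition vN_triple a b c : vN_elt :=
  2^-1 *: (vN_mul (vN_mul a (vN_star b)) c + vN_mul (vN_mul c (vN_star b)) a).

HB.instance Definition _ := hasTriple.Build R vN_elt vN_triple.

End VonNeumannTheory.

(* Main.v *)
Require Import Defs.
From HB Require Import structures.
From mathcomp Require Import all_boot all_order all_algebra.
From mathcomp Require Import complex.
From mathcomp Require Import all_classical all_reals all_analysis.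
From mathcomp Require Import ring.

(** Let T be a 2-local triple homomorphism into a JB*-triple and let e be a
    tripotent of the domain, that is, {e, e, e} = e. For all a and all complex
    z and w, the increment T(a + z e) - T(a + w e) equals (z - w) f(e) for some
    triple homomorphism f, so it is z - w times a tripotent. A curve all of
    whose difference quotients are tripotents is very rigid, and this forces
    T(a + e) = T(a) + T(e).

    To see it, put d = T(a + e) - T(a) and p = T(e), both tripotents. For a
    complex number w of modulus 1 and a small real s, the vector
    v(s) = T(w e + s a) - s T(a) is a tripotent, it tends to w p as s tends to
    0, and v(s) - s d = T(w e + s a) - s T(a + e) is w - s times a tripotent.
    Comparing the cubes of both sides to first order in s
    ([tripotent_first_order]) yields, for w = 1 and w = i,
      2 {p, p, d} + {p, d, p} = 2 p + d    and    2 {p, p, d} - {p, d, p} = d.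
    So x = d - p satisfies {p, p, x} = x / 2 and {p, x, p} = 0: it lies in the
    Peirce-1 space of p. When {d, d, d} = d is expanded with d = p + x, what
    remains is 2 {x, x, p} + {x, p, x} + {x, x, x} = 0, where the three terms
    are eigenvectors of {p, p, -} for the eigenvalues 1, 0 and 1/2. Hence
    {x, x, x} = 0, and x = 0 since the norm of {x, x, x} is the cube of the norm
    of x ([tripotent_rigid]).

    Consequently T is additive as soon as the tripotents span the domain
    ([two_local_is_triple_homomorphism]); it is homogeneous and preserves cubes
    because these properties involve two points only, and a linear map which
    preserves cubes preserves the triple product by polarisation
    ([tform_cube_eq0]). In a von Neumann algebra every unitary is a tripotent,
    and the unitaries span: a self-adjoint h of norm at most 1/2 is the mean of
    the unitaries h + i r and h - i r, where r is the square root of 1 - h h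
    ([vN_selfadjoint_unitaries]). That square root is obtained as 1 - y, where
    y is the limit of the contracting iteration y |-> (h h + y y) / 2; the limit
    stays in the algebra because the latter is a bicommutant. *)

Set Implicit Arguments.
Unset Strict Implicit.
Unset Printing Implicit Defensive.

Import Order.TTheory GRing.Theory Num.Theory.
Import numFieldNormedType.Exports.

Local Open Scope classical_set_scope.
Local Open Scope ring_scope.
Local Open Scope complex_scope.

(** * Identities in modules *)

Section Idealization.
Variables (K : comNzRingType) (V : lmodType K).

(** The square-zero extension of K by V. The module V embeds additively in this
    commutative ring, with scaling by k becoming multiplication by an element;
    so an identity between linear combinations in V is an instance of a
    polynomial identity, which ring decides. *)
Definition idealization := (K * V)%type.
HB.instance Definition _ := GRing.Zmodule.on idealization.

Implicit Types p q : idealization.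
Definition ideal_mul p q : idealization := (p.1 * q.1, p.1 *: q.2 + q.1 *: p.2).
Definition ideal_one : idealization := (1, 0).

Fact ideal_mulA : associative ideal_mul.
Proof.
move=> p q r; congr pair; rewrite /= ?mulrA// !scalerDr !scalerA -addrA.
by congr (_ + (_ + _)); rewrite mulrC.
Qed.

Fact ideal_mulC : commutative ideal_mul.
Proof. by move=> p q; rewrite /ideal_mul mulrC addrC. Qed.

Fact ideal_mul1 : left_id ideal_one ideal_mul.
Proof.
by move=> [k x]; rewrite /ideal_mul /= mul1r scale1r scaler0 addr0.
Qed.

Fact ideal_mulDl : left_distributive ideal_mul +%R.
Proof.
move=> p q r; congr pair; rewrite /= ?mulrDl//.
by rewrite scalerDl scalerDr addrACA.
Qed.

Fact ideal_1neq0 : ideal_one != 0.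
Proof. by apply/eqP => -[/eqP]; rewrite oner_eq0. Qed.

HB.instance Definition _ := GRing.Zmodule_isComNzRing.Build idealization
  ideal_mulA ideal_mulC ideal_mul1 ideal_mulDl ideal_1neq0.

Definition ideal_scalar (k : K) : idealization := (k, 0).
Definition ideal_vector (x : V) : idealization := (0, x).

Fact ideal_scalar_additive : nmod_morphism ideal_scalar.
Proof. by split=> // k l; congr pair; rewrite /= addr0. Qed.

Fact ideal_scalar_multiplicative : monoid_morphism ideal_scalar.
Proof. by split=> // k l; congr pair; rewrite /= !scaler0 addr0. Qed.

Fact ideal_vector_additive : nmod_morphism ideal_vector.
Proof. by split=> // x y; congr pair; rewrite /= addr0. Qed.

HB.instance Definition _ :=
  GRing.isNmodMorphism.Build _ _ ideal_scalar ideal_scalar_additive.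
HB.instance Definition _ :=
  GRing.isMonoidMorphism.Build _ _ ideal_scalar ideal_scalar_multiplicative.
HB.instance Definition _ :=
  GRing.isNmodMorphism.Build _ _ ideal_vector ideal_vector_additive.

Lemma ideal_vectorZ k x :
  ideal_vector (k *: x) = ideal_scalar k * ideal_vector x.
Proof.
by congr pair; rewrite /= ?mulr0// scale0r addr0.
Qed.

Lemma ideal_vectorD x y :
  ideal_vector (x + y) = ideal_vector x + ideal_vector y.
Proof. exact: raddfD. Qed.

Lemma ideal_vectorN x : ideal_vector (- x) = - ideal_vector x.
Proof. exact: raddfN. Qed.

Lemma ideal_vector0 : ideal_vector 0 = 0.
Proof. by []. Qed.

Definition ideal_vectorE := (ideal_vector0, ideal_vectorD, ideal_vectorN,
  ideal_vectorZ).

Lemma ideal_vector_inj : injective ideal_vector.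
Proof. by move=> x y []. Qed.

End Idealization.

Ltac module := apply: ideal_vector_inj; rewrite !ideal_vectorE; ring.

Section Scalars.
Variable R : realType.

Lemma scaler_halves (V : lmodType R[i]) (x : V) : x = 2^-1 *: x + 2^-1 *: x.
Proof.
rewrite -scalerDl; have -> : 2^-1 + 2^-1 = 1 :> R[i] by field.
by rewrite scale1r.
Qed.

Lemma scaler2_inj (V : lmodType R[i]) (x y : V) : 2 *: x = 2 *: y -> x = y.
Proof. by apply: scalerI; rewrite pnatr_eq0. Qed.

(** The three properties in which the imaginary unit enters below; they also
    hold for its opposite. *)
Lemma imaginary_unit :
  exists j : R[i], [/\ (j^*)%R = - j, j * j = -1 & `|j| = 1].
Proof.
pose j : R[i] := 'i; exists j; split.
- by apply/eqP; rewrite eq_complex /= oppr0 !eqxx.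
- by rewrite -expr2 sqr_i.
- by rewrite normc_def /= expr0n /= add0r expr1n sqrtr1.
Qed.

End Scalars.

(** * Symmetric sesquilinear ternary maps *)

(** This covers at once the triple products and, for a linear map T, the defect
    T {a, b, c} - {T a, T b, T c}, whose vanishing is to be proved. *)
Definition triple_form (R : realType) (E G : lmodType R[i])
    (t : E -> E -> E -> G) : Prop :=
  [/\ forall b c, linear (fun a => t a b c),
      forall a b c, t a b c = t c b a
    & forall (a c : E) (k : R[i]) (b b' : E),
        t a (k *: b + b') c = k^* *: t a b c + t a b' c].

Section TripleForm.
Variables (R : realType) (E G : lmodType R[i]) (t : E -> E -> E -> G).
Hypothesis tP : triple_form t.

Lemma tformC a b c : t a b c = t c b a.
Proof. by case: tP. Qed.

Lemma tformDl a a' b c : t (a + a') b c = t a b c + t a' b c.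
Proof. by case: tP => /(_ b c 1 a a'); rewrite !scale1r. Qed.

Lemma tformZl k a b c : t (k *: a) b c = k *: t a b c.
Proof.
have t0 : t 0 b c = 0.
  by apply: (addrI (t 0 b c)); rewrite -tformDl !addr0.
by case: tP => /(_ b c k a 0); rewrite t0 !addr0.
Qed.

Lemma tformDm a b b' c : t a (b + b') c = t a b c + t a b' c.
Proof. by case: tP => _ _ /(_ a c 1 b b'); rewrite rmorph1 !scale1r. Qed.

Lemma tformZm k a b c : t a (k *: b) c = k^* *: t a b c.
Proof.
have t0 : t a 0 c = 0.
  by apply: (addrI (t a 0 c)); rewrite -tformDm !addr0.
by case: tP => _ _ /(_ a c k b 0); rewrite t0 !addr0.
Qed.

Lemma tformDr a b c c' : t a b (c + c') = t a b c + t a b c'.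
Proof. by rewrite tformC tformDl !(tformC _ b a). Qed.

Lemma tformZr k a b c : t a b (k *: c) = k *: t a b c.
Proof. by rewrite tformC tformZl tformC. Qed.

Lemma tformNm a b c : t a (- b) c = - t a b c.
Proof. by rewrite -scaleN1r tformZm rmorphN rmorph1 scaleN1r. Qed.

Lemma tformNr a b c : t a b (- c) = - t a b c.
Proof. by rewrite -scaleN1r tformZr scaleN1r. Qed.

Lemma tform_cubeD a b : t (a + b) (a + b) (a + b) =
  t a a a + (2 *: t a a b + t a b a) + (2 *: t b b a + t b a b) + t b b b.
Proof.
rewrite !(tformDl, tformDm, tformDr) (tformC b a a) (tformC a b b); module.
Qed.

Lemma tform_cubeZ k a :
  t (k *: a) (k *: a) (k *: a) = (`|k| ^+ 2 * k) *: t a a a.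
Proof.
by rewrite tformZl tformZm tformZr !scalerA sqr_normc; congr (_ *: _); ring.
Qed.

(** Polarisation. The part of the cube of a + k b that is odd in b, up to the
    cube of k b, is k (2 t a a b) + k^* (t a b a); taking k = 1 and k = i
    separates the two terms because only the second is antilinear in b. *)
Lemma tform_cube_eq0 : (forall a, t a a a = 0) -> forall a b c, t a b c = 0.
Proof.
move=> t3.
have aba a b : t a b a = 0.
  have odd (k : R[i]) : k *: (2 *: t a a b) + k^* *: t a b a = 0.
    have := tform_cubeD a (- k *: b); have := tform_cubeD a (k *: b).
    rewrite !t3 !(tformZl, tformZm, tformZr) !rmorphN => e1 e2.
    apply: scaler2_inj; rewrite scaler0.
    by rewrite -[RHS](subrr 0) [X in X - _]e1 [X in _ - X]e2; module.
  have e1 : 2 *: t a a b + t a b a = 0.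
    by have := odd 1; rewrite rmorph1 !scale1r.
  have e2 : 2 *: t a a b - t a b a = 0.
    have [j [cj _ j1]] := imaginary_unit R.
    have j0 : j != 0 by rewrite -normr_eq0 j1 oner_eq0.
    apply: (scalerI j0); rewrite scaler0 -[RHS](odd j) cj; module.
  apply: scaler2_inj; rewrite scaler0.
  by rewrite -[RHS](subrr 0) -{1}e1 -e2; module.
move=> a b c; have := aba (a + c) b.
rewrite tformDl !tformDr !aba (tformC c) add0r addr0 => e.
by apply: scaler2_inj; rewrite scaler0 -[RHS]e; module.
Qed.

End TripleForm.

(** * Tripotents of a JB*-triple *)

Section JBTripleTheory.
Variables (R : realType) (F : jbTripleType R).
Implicit Types d e : F.

Definition tripotent (E : tripleModType R) (e : E) := triple e e e = e.

Lemma jb_triple_form : triple_form (@triple R F).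
Proof.
by split; [exact: triple_linear|exact: triple_sym|exact: triple_antilinear].
Qed.

Lemma tripotent_norm_le1 e : tripotent e -> `|e| <= 1.
Proof.
move=> /(congr1 (fun x => `|x|)); rewrite triple_norm => e3.
have [->|e0] := eqVneq e 0; first by rewrite normr0.
have ne : `|e| != 0 by rewrite normr_eq0.
have /eqP : `|e| ^+ 2 = 1 by apply: (mulIf ne); rewrite mul1r -exprSr.
by rewrite sqrp_eq1// => /eqP->.
Qed.

(** The hypotheses say that x = d - e lies in the Peirce-1 space of e; the
    eigenspaces of {e, e, -} for the eigenvalues 0, 1/2 and 1 are independent,
    and the part of {d, d, d} = d in the one for 1/2 gives {x, x, x} = 0. *)
Lemma tripotent_rigid d e : tripotent d -> tripotent e ->
  2 *: triple e e d = d + e -> triple e d e = e -> d = e.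
Proof.
move=> d3 e3 eed ede; have tP := jb_triple_form.
pose x := d - e.
have dE : d = e + x by rewrite addrC subrK.
have h2 : (2 : R[i])^-1 * 2 = 1 by rewrite mulVf// pnatr_eq0.
have eex : triple e e x = 2^-1 *: x.
  rewrite /x (tformDr tP) (tformNr tP) e3 [X in _ - X = _]scaler_halves.
  have -> : triple e e d = 2^-1 *: (d + e) by rewrite -eed scalerA h2 scale1r.
  module.
have exe : triple e x e = 0.
  by rewrite /x (tformDm tP) (tformNm tP) e3 ede subrr.
set u := triple x x e; set v := triple x e x; set w := triple x x x.
have s0 : 2 *: u + v + w = 0.
  have := d3; rewrite /tripotent dE (tform_cubeD tP) e3 eex exe -/u -/v -/w.
  rewrite scalerA [2 * _]mulrC h2 scale1r addr0 -!addrA => /addrI.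
  by move=> h; apply: (addrI x); rewrite addr0 -!addrA.
have c2 : ((2^-1 : R[i])^*)%R = 2^-1 by rewrite fmorphV rmorph_nat.
(* {e, e, -} acts on triple products as a derivation, with a sign in the
   middle variable: it maps products of eigenvectors to eigenvectors. *)
have L y z r : triple e e (triple y z r) =
    triple (triple e e y) z r - triple y (triple e e z) r
    + triple y z (triple e e r).
  by rewrite -[LHS](subrK (triple y z (triple e e r))) tripleL.
have Lu : triple e e u = u.
  by rewrite L eex e3 (tformZl tP) (tformZm tP) c2 subrr add0r.
have Lv : triple e e v = 0.
  rewrite L eex e3 (tformZl tP) (tformZr tP) -/v [X in _ - X + _]scaler_halves.
  module.
have Lw : triple e e w = 2^-1 *: w.
  by rewrite L eex (tformZl tP) (tformZm tP) (tformZr tP) c2 subrr add0r.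
have L0 : triple e e 0 = 0.
  by rewrite -(scale0r e) (tformZr tP) !scale0r.
have s1 : 2 *: u + 2^-1 *: w = 0.
  have := congr1 (triple e e) s0.
  by rewrite !(tformDr tP) (tformZr tP) Lu Lv Lw addr0 L0.
have s2 : 2 *: u + 2^-1 *: (2^-1 *: w) = 0.
  have := congr1 (triple e e) s1.
  by rewrite !(tformDr tP) !(tformZr tP) Lu Lw L0.
have /eqP : 2^-1 *: (2^-1 *: w) = 0.
  rewrite -[RHS](subrr 0) -[X in X - _]s1 -[X in _ - X]s2.
  by rewrite [X in _ + X - _]scaler_halves; module.
rewrite !scaler_eq0 invr_eq0 pnatr_eq0 /= => /eqP/(congr1 (fun x => `|x|)).
rewrite triple_norm normr0 => /eqP; rewrite expf_eq0 /= normr_eq0 subr_eq0.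
by move=> /eqP.
Qed.

End JBTripleTheory.

(** * Limits in complex normed spaces *)

Section Limits.
Variable R : realType.

Lemma cvg_of_norm_le (V : normedModType R[i]) (u : nat -> V) (l : V)
    (r : nat -> R) :
  (forall n, `|u n - l| <= (r n)%:C) -> r n @[n --> \oo] --> (0 : R) ->
  u n @[n --> \oo] --> l.
Proof.
move=> ur r0; apply/cvgrPdist_lt => eps eps0.
have epsE : eps = (complex.Re eps)%:C.
  by rewrite RRe_real// ger0_real// ltW.
have := eps0; rewrite epsE ltcR => /= Reps0.
move/cvgrPdist_lt : r0 => /(_ _ Reps0); apply: filterS => n.
rewrite sub0r normrN => rn; rewrite distrC (le_lt_trans (ur n))// ltcR.
by rewrite (le_lt_trans (ler_norm _)).
Qed.

Lemma cvg_div_exp2 (c : R) : c / 2 ^+ n @[n --> \oo] --> (0 : R).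
Proof.
have := @cvg_geometric R c (2^-1).
rewrite ger0_norm ?invr_ge0// invf_lt1// ltr1n => /(_ isT).
by apply: cvg_trans; apply: near_eq_cvg; apply: nearW => n; rewrite /= exprVn.
Qed.

(** This is applied to operators at a point, with c proportional to the norm of
    the point; the explicit rate then amounts to convergence in norm. *)
Lemma geometric_cauchy (V : completeNormedModType R[i]) (u : nat -> V)
    (c : R) : 0 <= c ->
  (forall n, `|u n.+1 - u n| <= (c / 2 ^+ n)%:C) ->
  exists l, forall n, `|u n - l| <= (c * 2 / 2 ^+ n)%:C.
Proof.
move=> c0 uc.
have tail n m :
    `|u (n + m)%N - u n| <= (c * 2 / 2 ^+ n - c * 2 / 2 ^+ (n + m))%:C.
  elim: m => [|m IH]; first by rewrite addn0 !subrr normr0.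
  rewrite -(subrKA (u (n + m)%N)) (le_trans (ler_normD _ _))// addnS.
  apply: le_trans (lerD (uc _) IH) _; rewrite -rmorphD lecR exprS.
  by rewrite le_eqVlt; apply/orP; left; apply/eqP; field; rewrite !expf_neq0.
have tail' n m : (n <= m)%N -> `|u m - u n| <= (c * 2 / 2 ^+ n)%:C.
  move=> nm; rewrite -(subnKC nm) (le_trans (tail _ _))// lecR gerBl//.
  by rewrite divr_ge0 ?mulr_ge0 ?exprn_ge0.
have uE : cvg (u @ \oo).
  apply/cauchy_cvgP/cauchy_exP => eps eps0.
  have epsE : eps = (complex.Re eps)%:C by rewrite RRe_real// ger0_real// ltW.
  have := eps0; rewrite epsE ltcR => /= Reps0.
  have /cvgrPdist_lt/(_ _ Reps0)[N _ /(_ N (leqnn _))] := cvg_div_exp2 (c * 2).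
  rewrite sub0r normrN => /(le_lt_trans (ler_norm _)) Neps.
  exists (u N); exists N => // m /= Nm.
  rewrite -ball_normE /ball_ /= distrC epsE (le_lt_trans (tail' _ _ Nm))//.
  by rewrite ltcR.
exists (lim (u @ \oo)) => n.
apply/ler_addgt0Pr => eps eps0.
have [N _ uN] := (cvgrPdist_lt _ _).1 uE _ eps0.
have ul := uN (maxn n N) (leq_maxr _ _).
rewrite -(subrKA (u (maxn n N))) (le_trans (ler_normD _ _))// lerD//.
  by rewrite distrC tail'// leq_maxl.
by rewrite distrC ltW.
Qed.

Lemma cvg_of_geometric (V : normedModType R[i]) (u : nat -> V) (l : V)
    (c : R) (t : R[i]) :
  0 <= t -> (forall n, `|u n - l| <= (c / 2 ^+ n)%:C * t) ->
  u n @[n --> \oo] --> l.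
Proof.
move=> t0 ul; have /complex_realP[r tE] := ger0_real t0.
apply: (@cvg_of_norm_le _ _ _ (fun n => c / 2 ^+ n * r)).
  by move=> n; rewrite rmorphM /= -tE.
by rewrite -[X in _ --> X](mul0r r); apply: cvgMl; exact: cvg_div_exp2.
Qed.

Lemma cvg_lipschitz (V W : normedModType R[i]) (f : V -> W) (c : R[i])
    (u : nat -> V) (x : V) : 0 <= c ->
  (forall v w : V, `|f v - f w| <= c * `|v - w|) ->
  u n @[n --> \oo] --> x -> f (u n) @[n --> \oo] --> f x.
Proof.
move=> c0 fc ux; apply/cvgrPdist_lt => eps eps0.
have c1 : 0 < c + 1 by rewrite ltr_wpDl.
have /cvgrPdist_lt/(_ _ (divr_gt0 eps0 c1)) := ux; apply: filterS => n.
rewrite ltr_pdivlMr// mulrC; apply: le_lt_trans.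
by rewrite (le_trans (fc _ _))// ler_wpM2r// lerDl.
Qed.

Lemma bounded_linear_cvg (V W : normedModType R[i]) (f : V -> W)
    (u : nat -> V) (x : V) :
  bounded_linear f -> u n @[n --> \oo] --> x -> f (u n) @[n --> \oo] --> f x.
Proof.
move=> bf; have [c c0 fc] := bounded_linear_nneg bf.
apply: (cvg_lipschitz (c := c%:C)) => [|v w]; first by rewrite ler0c.
have -> : f v - f w = f (v - w); last exact: fc.
by have := bf.1 (-1) w v; rewrite !scaleN1r ![- _ + _]addrC.
Qed.

End Limits.

(** * Nearby tripotents to first order *)

Section FirstOrder.
Variables (R : realType) (F : jbTripleType R).
Implicit Types d e : F.

Lemma triple_cvg (u v w : nat -> F) (a b c : F) :
  u n @[n --> \oo] --> a -> v n @[n --> \oo] --> b -> w n @[n --> \oo] --> c ->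
  triple (u n) (v n) (w n) @[n --> \oo] --> triple a b c.
Proof.
move=> ua vb wc.
exact: (cvg_comp _ (fun p : F * F * F => triple p.1.1 p.1.2 p.2)
  (cvg_pair (cvg_pair ua vb) wc) (@triple_continuous _ F (a, b, c))).
Qed.

(** With s = r n, the cube of (om - s) g is |om - s|^2 times itself, and
    |om - s|^2 = 1 - s (om + om^* ) + s^2. Expanding the cube of v - s d, where
    v and d are tripotents, the terms of order 0 cancel; the remaining ones are
    divisible by s, and the limit of the quotient is the stated identity. *)
Lemma tripotent_first_order (v : nat -> F) (r : nat -> R) (om : R[i]) e d :
  `|om| = 1 -> tripotent d ->
  (forall n, r n != 0) -> r n @[n --> \oo] --> (0 : R) ->
  v n @[n --> \oo] --> e -> (forall n, tripotent (v n)) ->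
  (forall n, exists2 g,
    tripotent g & v n - (r n)%:C *: d = (om - (r n)%:C) *: g) ->
  2 *: triple e e d + triple e d e = (om + (om^*)%R) *: e + d.
Proof.
move=> om1 d3 rn0 r0 ve v3 vd; have tP := @jb_triple_form R F.
pose s n : R[i] := (r n)%:C.
have s0 : s n @[n --> \oo] --> (0 : R[i]^o).
  apply: (@cvg_of_norm_le R R[i]^o s 0 (fun n => `|r n|)).
    by move=> n; rewrite subr0 normc_def /= expr0n /= addr0 sqrtr_sqr.
  by rewrite -(normr0 R); exact: cvg_norm.
pose k : R[i] := om + (om^*)%R.
pose A x : F := 2 *: triple x x d + triple x d x.
pose B x : F := 2 *: triple d d x + triple d x d.
have AE n : A (v n) = k *: v n + d + s n *: (B (v n) - v n - k *: d).
  have [g g3 gE] := vd n.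
  have sn0 : s n != 0 by rewrite eq_complex /= negb_and rn0.
  have cs : ((s n)^*)%R = s n by apply/eqP; rewrite eq_complex /= oppr0 !eqxx.
  have cNs : ((- s n)^*)%R = - s n.
    by apply/eqP; rewrite eq_complex /= !oppr0 !eqxx.
  have := tform_cubeZ tP (om - s n) g; rewrite -gE -/(s n) g3 -scalerA -gE.
  have -> : `|om - s n| ^+ 2 = 1 - s n * k + s n ^+ 2.
    have normJ z : `|z| ^+ 2 = z * (z^*)%R :> R[i] by exact: sqr_normc.
    rewrite normJ rmorphB /= cs mulrBl !mulrBr -normJ om1 /k expr1n; ring.
  rewrite -scaleNr (tform_cubeD tP) !(tformZl tP, tformZm tP, tformZr tP).
  rewrite !cNs v3 d3 => cE.
  apply: (scalerI sn0); apply/eqP; rewrite -subr_eq0.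
  move/eqP: cE; rewrite -subr_eq0 -oppr_eq0 => /eqP cE.
  by apply/eqP; rewrite -[RHS]cE /A /B; module.
have Acvg : A (v n) @[n --> \oo] --> A e.
  by apply: cvgD; [apply: cvgZr|]; apply: triple_cvg => //; exact: cvg_cst.
have Bcvg : B (v n) @[n --> \oo] --> B e.
  by apply: cvgD; [apply: cvgZr|]; apply: triple_cvg => //; exact: cvg_cst.
have : A (v n) @[n --> \oo] --> k *: e + d + 0 *: (B e - e - k *: d).
  under eq_cvg do rewrite AE.
  apply: cvgD; first by apply: cvgD; [exact: cvgZr|exact: cvg_cst].
  apply: cvgZ => //; apply: cvgB; last exact: cvg_cst.
  exact: cvgB.
rewrite scale0r addr0 => /(cvg_unique _ Acvg).
by apply.
Qed.

End FirstOrder.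

(** * Two-local triple homomorphisms *)

Section TwoLocal.
Variables (R : realType) (E : tripleModType R) (F : jbTripleType R).
Variable T : E -> F.
Hypothesis T2 : two_local_triple_homomorphism T.

Lemma two_localZ k a : T (k *: a) = k *: T a.
Proof.
have [f [[lf _] _ <- <-]] := T2 a (k *: a).
have f0 : f 0 = 0.
  by have := lf (-1) 0 0; rewrite scaler0 addr0 scaleN1r addNr.
by have := lf k a 0; rewrite f0 !addr0.
Qed.

Lemma two_local_cube a : T (triple a a a) = triple (T a) (T a) (T a).
Proof. by have [f [[_ ft] _ <- <-]] := T2 a (triple a a a). Qed.

Lemma two_local_increment a e k : tripotent e ->
  exists2 g, tripotent g & T (a + k *: e) = T a + k *: g.
Proof.
move=> e3; have [f [[lf ft] _ <- <-]] := T2 a (a + k *: e).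
exists (f e); first by rewrite /tripotent -ft e3.
by rewrite addrC lf addrC.
Qed.

(** Tripotents have norm at most 1, which bounds the increments of T along the
    multiples of a tripotent; the bound passes to linear combinations. *)
Definition directionally_lipschitz a :=
  exists c : R, forall x k, `|T (x + k *: a) - T x| <= `|k| * c%:C.

Lemma directionally_lipschitz_tripotent e :
  tripotent e -> directionally_lipschitz e.
Proof.
move=> e3; exists 1 => x k; rewrite mulr1.
have [g g3 ->] := two_local_increment x k e3.
by rewrite addrC addKr normrZ ler_piMr// tripotent_norm_le1.
Qed.

Lemma directionally_lipschitzD a b : directionally_lipschitz a ->
  directionally_lipschitz b -> directionally_lipschitz (a + b).
Proof.
move=> [c ac] [d bd]; exists (c + d) => x k; rewrite scalerDr addrA.
rewrite -(subrKA (T (x + k *: a))) (le_trans (ler_normD _ _))//.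
by rewrite rmorphD mulrDr [leRHS]addrC lerD.
Qed.

Lemma directionally_lipschitzZ k a :
  directionally_lipschitz a -> directionally_lipschitz (k *: a).
Proof.
move=> [c ac]; have /complex_realP[r rE] : `|k| \is Num.real.
  exact: normr_real.
exists (r * c) => x l; rewrite scalerA rmorphM /= -rE mulrA -normrM.
exact: ac.
Qed.

(** The increment d of T at a in the direction e is compared with T e through
    the tripotents v n = T (om e + s a) - s T a, which tend to om (T e). *)
Lemma two_local_addr_tripotent a e : directionally_lipschitz a -> tripotent e ->
  T (a + e) = T a + T e.
Proof.
move=> [c ac] e3.
have [d d3 dE] := two_local_increment a 1 e3; rewrite !scale1r in dE.
have Te3 : tripotent (T e) by rewrite /tripotent -two_local_cube e3.
rewrite dE; congr (_ + _).
have first om : `|om| = 1 ->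
    2 *: triple (om *: T e) (om *: T e) d + triple (om *: T e) d (om *: T e)
      = (om + (om^*)%R) *: (om *: T e) + d.
  move=> om1; pose r n : R := n.+1%:R^-1.
  pose s n : R[i] := (r n)%:C.
  have r0 : r n @[n --> \oo] --> (0 : R) by exact: cvg_harmonic.
  have rn0 n : r n != 0 by rewrite invr_eq0 pnatr_eq0.
  have sn0 n : s n != 0 by rewrite eq_complex /= negb_and rn0.
  pose v n := T (om *: e + s n *: a) - s n *: T a.
  have vE n : v n = s n *: (T (a + ((s n)^-1 * om) *: e) - T a).
    rewrite /v scalerBr -[s n *: T (a + _)]two_localZ scalerDr scalerA.
    by rewrite mulrA divff// mul1r [om *: e + _]addrC.
  apply: (@tripotent_first_order _ _ v r) => //.
  - have /complex_realP[q qE] : `|T a| \is Num.real by exact: normr_real.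
    apply: (@cvg_of_norm_le _ _ _ _ (fun n => r n * (c + q))).
      move=> n; rewrite /v -[om *: T e]two_localZ addrAC.
      rewrite (le_trans (ler_normD _ _))// normrN normrZ qE.
      have sE : `|s n| = s n by rewrite ger0_norm// ler0c invr_ge0.
      rewrite rmorphM rmorphD mulrDr /= -/(s n) -[X in X * c%:C]sE.
      by rewrite -[X in _ <= _ + X * _]sE lerD.
    by rewrite -[X in _ --> X](mul0r (c + q)); apply: cvgMl.
  - move=> n; rewrite vE.
    have [g g3 ->] := two_local_increment a ((s n)^-1 * om) e3.
    rewrite [T a + _]addrC addrK scalerA mulrA divff// mul1r.
    rewrite /tripotent (tform_cubeZ (@jb_triple_form R F)) om1 expr1n mul1r.
    by rewrite g3.
  - move=> n.
    have [g g3 gE] := two_local_increment (a + e) ((s n)^-1 * om - 1) e3.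
    exists g => //; rewrite vE.
    have -> : a + ((s n)^-1 * om) *: e = a + e + ((s n)^-1 * om - 1) *: e.
      by module.
    rewrite gE dE -/(s n).
    have -> : s n *: (T a + d + ((s n)^-1 * om - 1) *: g - T a) - s n *: d
       = (s n / s n * om - s n) *: g by module.
    by rewrite divff// mul1r.
have tP := @jb_triple_form R F.
have [j [cj jj j1]] := imaginary_unit R.
have ej : 2 *: triple (T e) (T e) d - triple (T e) d (T e) = d.
  have := first j j1; rewrite !(tformZl tP, tformZm tP, tformZr tP) cj.
  by rewrite subrr scale0r add0r !scalerA -mulrA mulrN jj opprK mulr1 scaleN1r.
have := first 1 (normr1 _); rewrite !scale1r rmorph1 => e1.
apply: tripotent_rigid => //; apply: scaler2_inj.
  have -> : 2 *: (d + T e) = d + ((1 + 1) *: T e + d) by module.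
  by rewrite -e1 -[X in _ = X + _]ej; module.
have -> : 2 *: T e = (1 + 1) *: T e + d - d by module.
by rewrite -e1 -[X in _ = _ - X]ej; module.
Qed.

End TwoLocal.

(** The linear span of the tripotents is the whole space, phrased as an
    induction principle. *)
Definition spanned_by_tripotents (R : realType) (E : tripleModType R) : Prop :=
  forall P : E -> Prop, (forall a b, P a -> P b -> P (a + b)) ->
    (forall k a, P a -> P (k *: a)) -> (forall e, tripotent e -> P e) ->
  forall a, P a.

Theorem two_local_is_triple_homomorphism (R : realType) (E : tripleModType R)
    (F : jbTripleType R) (T : E -> F) :
  triple_form (@triple R E) -> spanned_by_tripotents E ->
  two_local_triple_homomorphism T -> triple_homomorphism T.
Proof.
move=> EP Espan T2; have FP := @jb_triple_form R F.
have TZ := two_localZ T2.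
have lip a : directionally_lipschitz T a.
  apply: Espan a; first exact: directionally_lipschitzD.
    exact: directionally_lipschitzZ.
  exact: directionally_lipschitz_tripotent.
have TD b a : T (a + b) = T a + T b.
  move: a; pattern b; apply: Espan b.
  - by move=> b c bP cP a; rewrite addrA (cP (a + b)) (bP a) (cP b) addrA.
  - move=> k b bP a; have [->|k0] := eqVneq k 0.
      by rewrite TZ !scale0r !addr0.
    have -> : a + k *: b = k *: (k^-1 *: a + b).
      by rewrite scalerDr scalerA divff// scale1r.
    by rewrite [T (k *: (_ + _))]TZ bP !TZ scalerDr !scalerA divff// !scale1r.
  - by move=> e e3 a; exact: two_local_addr_tripotent.
split=> [k a b|a b c]; first by rewrite TD TZ.
pose t a b c := T (triple a b c) - triple (T a) (T b) (T c).
apply/eqP; rewrite -subr_eq0 -/(t a b c); apply/eqP.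
apply: tform_cube_eq0 => [|{}a]; last by rewrite /t (two_local_cube T2) subrr.
split=> [{}b {}c k x y|x y z|{}a {}c k x y]; rewrite /t.
- rewrite (tformDl EP) (tformZl EP) !TD !TZ (tformDl FP) (tformZl FP); module.
- by rewrite (tformC EP) (tformC FP).
- rewrite (tformDm EP) (tformZm EP) !TD !TZ (tformDm FP) (tformZm FP); module.
Qed.

(** * Operators on a Hilbert space *)

Section InnerProduct.
Variables (R : realType) (H : hilbertType R).
Implicit Types (x y z : H) (a b : H -> H).

Lemma innerDl x y z : inner (x + y) z = inner x z + inner y z.
Proof. by have := inner_linear 1 x y z; rewrite scale1r mul1r. Qed.

Lemma inner0l z : inner 0 z = 0.
Proof. by apply: (addrI (inner 0 z)); rewrite -innerDl !addr0. Qed.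

Lemma innerZl k x z : inner (k *: x) z = k * inner x z.
Proof. by have := inner_linear k x 0 z; rewrite inner0l !addr0. Qed.

Lemma innerC x y : inner x y = ((inner y x)^*)%R.
Proof. exact: inner_conj. Qed.

Lemma innerDr x y z : inner x (y + z) = inner x y + inner x z.
Proof. by rewrite innerC innerDl rmorphD /= -!innerC. Qed.

Lemma innerZr k x y : inner x (k *: y) = (k^*)%R * inner x y.
Proof. by rewrite innerC innerZl rmorphM /= -innerC. Qed.

Lemma innerNl x y : inner (- x) y = - inner x y.
Proof. by rewrite -scaleN1r innerZl mulN1r. Qed.

Lemma innerNr x y : inner x (- y) = - inner x y.
Proof. by rewrite innerC innerNl rmorphN /= -innerC. Qed.

Lemma inner_injr x y : (forall z, inner z x = inner z y) -> x = y.
Proof.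
move=> xy; apply/eqP; rewrite -subr_eq0 -normr_eq0 -sqrf_eq0 -inner_norm.
by rewrite innerDr innerNr xy subrr.
Qed.

Lemma cauchy_schwarz x y : `|inner x y| <= `|x| * `|y|.
Proof.
have [->|y0] := eqVneq y 0.
  by rewrite innerC inner0l rmorph0 !normr0 mulr0.
have ny : 0 < `|y| ^+ 2 by rewrite exprn_gt0// normr_gt0.
have cy : ((`|y| ^+ 2)^*)%R = `|y| ^+ 2 by rewrite geC0_conj// ltW.
(* t *: y is the orthogonal projection of x on the line spanned by y. *)
pose t := inner x y / `|y| ^+ 2.
have : 0 <= inner (x - t *: y) (x - t *: y) by rewrite inner_norm exprn_ge0.
have normJ (k : R[i]) : `|k| ^+ 2 = k * (k^*)%R by exact: sqr_normc.
rewrite innerDl !innerDr !innerNl !innerNr !innerZl !innerZr !inner_norm.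
rewrite (innerC y x).
have -> : (t^*)%R = (inner x y)^*%R / `|y| ^+ 2.
  by rewrite /t rmorphM fmorphV /= cy.
set p := inner x y; set q := (p^*)%R; set n := `|x| ^+ 2.
have -> : n - q / `|y| ^+ 2 * p
      + (- (t * q) - - (t * (q / `|y| ^+ 2 * `|y| ^+ 2)))
    = n - `|p| ^+ 2 / `|y| ^+ 2.
  by rewrite normJ -/q /t -/p; field; rewrite normr_eq0.
rewrite subr_ge0 ler_pdivrMr// /n -exprMn.
by rewrite ler_sqr// nnegrE ?mulr_ge0.
Qed.

Lemma is_adjointC a b : is_adjoint a b -> is_adjoint b a.
Proof. by move=> ab x y; rewrite innerC -ab -innerC. Qed.

Lemma is_adjoint_uniq a b c : is_adjoint a b -> is_adjoint a c -> b = c.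
Proof.
by move=> ab ac; apply/funext => y; apply: inner_injr => x; rewrite -ab ac.
Qed.

End InnerProduct.

(** * The triple structure of a von Neumann algebra *)

Section VonNeumannTriple.
Variables (R : realType) (H : hilbertType R) (A : vonNeumannAlgebra H).
Implicit Types (a b c : vN_elt A) (x y : H).

Lemma vN_ext a b : (forall x, val a x = val b x) -> a = b.
Proof. by move=> ab; apply: val_inj; apply/funext. Qed.

Lemma vN_DE a b x : val (a + b) x = val a x + val b x.
Proof. by rewrite raddfD. Qed.

Lemma vN_ZE k a x : val (k *: a) x = k *: val a x.
Proof. by rewrite linearZ. Qed.

Lemma vN_NE a x : val (- a) x = - val a x.
Proof. by rewrite raddfN. Qed.

Lemma vN_0E x : val (0 : vN_elt A) x = 0.
Proof. by rewrite raddf0. Qed.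

Lemma vN_mulE a b x : val (vN_mul a b) x = val a (val b x).
Proof. by []. Qed.

Definition vN_E := (vN_DE, vN_ZE, vN_NE, vN_0E, vN_mulE).

Lemma vN_linear a : linear (val a).
Proof. by have [] := vN_bounded (vN_valP a). Qed.

Lemma vN_D a x y : val a (x + y) = val a x + val a y.
Proof. by have := vN_linear a 1 x y; rewrite !scale1r. Qed.

Lemma vN_0 a : val a 0 = 0.
Proof. by apply: (addrI (val a 0)); rewrite -vN_D !addr0. Qed.

Lemma vN_Z a k x : val a (k *: x) = k *: val a x.
Proof. by have := vN_linear a k x 0; rewrite vN_0 !addr0. Qed.

Lemma vN_N a x : val a (- x) = - val a x.
Proof. by rewrite -scaleN1r vN_Z scaleN1r. Qed.

Lemma vN_starE a b : is_adjoint (val a) (val b) -> vN_star a = b.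
Proof.
by move=> ab; apply: val_inj; apply: is_adjoint_uniq (vN_starP a) ab.
Qed.

Lemma vN_starK a : vN_star (vN_star a) = a.
Proof. exact/vN_starE/is_adjointC/vN_starP. Qed.

Lemma vN_starD a b : vN_star (a + b) = vN_star a + vN_star b.
Proof.
apply: vN_starE => x y.
by rewrite !vN_E innerDl innerDr !vN_starP.
Qed.

Lemma vN_starZ k a : vN_star (k *: a) = (k^*)%R *: vN_star a.
Proof.
apply: vN_starE => x y.
by rewrite !vN_E innerZl innerZr vN_starP conjCK.
Qed.

Lemma vN_star0 : vN_star (0 : vN_elt A) = 0.
Proof.
by apply: vN_starE => x y; rewrite !vN_E inner0l innerC inner0l rmorph0.
Qed.

Lemma vN_starM a b : vN_star (vN_mul a b) = vN_mul (vN_star b) (vN_star a).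
Proof. by apply: vN_starE => x y; rewrite !vN_E !vN_starP. Qed.

Lemma vN_mulDl a b c : vN_mul (a + b) c = vN_mul a c + vN_mul b c.
Proof. by apply: vN_ext => x; rewrite !vN_E. Qed.

Lemma vN_mulDr a b c : vN_mul a (b + c) = vN_mul a b + vN_mul a c.
Proof. by apply: vN_ext => x; rewrite !vN_E vN_D. Qed.

Lemma vN_mulZl k a b : vN_mul (k *: a) b = k *: vN_mul a b.
Proof. by apply: vN_ext => x; rewrite !vN_E. Qed.

Lemma vN_mulZr k a b : vN_mul a (k *: b) = k *: vN_mul a b.
Proof. by apply: vN_ext => x; rewrite !vN_E vN_Z. Qed.

Lemma vN_mulA a b c : vN_mul a (vN_mul b c) = vN_mul (vN_mul a b) c.
Proof. exact: vN_ext. Qed.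

Lemma vN_one_subproof : vN_set A idfun.
Proof.
apply/vN_bicommutantP; split.
  by split; [move=> ? ? ?|exists 1 => x; rewrite mul1r].
by move=> c _; apply/funext.
Qed.

Definition vN_one : vN_elt A :=
  exist _ idfun (mem_set vN_one_subproof).

Lemma vN_triple_form : triple_form (@triple R (vN_elt A)).
Proof.
split=> [b c k x y|a b c|a c k b b']; rewrite /triple /= /vN_triple.
- rewrite !(vN_mulDl, vN_mulDr, vN_mulZl, vN_mulZr); module.
- by rewrite addrC.
- rewrite !(vN_starD, vN_starZ, vN_mulDl, vN_mulDr, vN_mulZl, vN_mulZr); module.
Qed.

Lemma unitary_tripotent a : vN_mul a (vN_star a) = vN_one -> tripotent a.
Proof.
move=> u; rewrite /tripotent /triple /= /vN_triple u.
have -> : vN_mul vN_one a = a by exact: vN_ext.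
by rewrite scalerDr -scaler_halves.
Qed.
End VonNeumannTriple.

(** * Square roots and unitaries *)

Section SquareRoot.
Variables (R : realType) (H : hilbertType R) (A : vonNeumannAlgebra H).
Implicit Types (a b c h y l : vN_elt A).

(** Whatever commutes with the algebra commutes with all y n, hence with their
    pointwise limit, which therefore lies in the bicommutant. *)
Lemma vN_geometric_cauchy (y : nat -> vN_elt A) (c : R) : 0 <= c ->
  (forall n x, `|val (y n.+1) x - val (y n) x| <= (c / 2 ^+ n)%:C * `|x|) ->
  exists l, forall n x, `|val (y n) x - val l x| <= (c * 2 / 2 ^+ n)%:C * `|x|.
Proof.
move=> c0 yc.
have /choice[l lP] : forall x, exists lx, forall n,
    `|val (y n) x - lx| <= (c * 2 / 2 ^+ n)%:C * `|x|.
  move=> x; have /complex_realP[r rE] : `|x| \is Num.real by exact: normr_real.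
  have r0 : 0 <= r by rewrite -lecR -rE; exact: normr_ge0.
  have [||lx lxP] := @geometric_cauchy _ _ (fun n => val (y n) x) (c * r).
  - exact: mulr_ge0.
  - by move=> n; rewrite (le_trans (yc n x))// rE -rmorphM mulrAC.
  - exists lx => n; rewrite (le_trans (lxP n))// rE -rmorphM lecR.
    by have -> : c * r * 2 / 2 ^+ n = c * 2 / 2 ^+ n * r by ring.
have yl x : val (y n) x @[n --> \oo] --> l x.
  exact: cvg_of_geometric (lP x).
have ll : linear l.
  move=> k x z; have := yl (k *: x + z).
  have -> : (fun n => val (y n) (k *: x + z)) =
      (fun n => k *: val (y n) x + val (y n) z).
    by apply/funext => n; rewrite vN_D vN_Z.
  move=> /(cvg_unique (@norm_hausdorff _ _)); apply.
  by apply: cvgD; [apply: cvgZr|]; exact: yl.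
have bl : bounded_linear l.
  have [_ [d yd]] := vN_bounded (vN_valP (y 0%N)).
  split=> //; exists ((c * 2 / 2 ^+ 0)%:C + d) => x.
  rewrite -[l x](subrK (val (y 0%N) x)) (le_trans (ler_normD _ _))// mulrDl.
  by rewrite lerD// distrC.
have Al : vN_set A l.
  apply/vN_bicommutantP; split=> // f fA; apply/funext => x /=.
  have bf : bounded_linear f by case: fA.
  have := bounded_linear_cvg bf (yl x).
  have -> : (fun n => f (val (y n) x)) = (fun n => val (y n) (f x)).
    apply/funext => n.
    by have /vN_bicommutantP[_ /(_ _ fA)/(congr1 (@^~ x))] := vN_valP (y n).
  move=> /(cvg_unique (@norm_hausdorff _ _)); apply.
  exact: yl.
by exists (exist _ l (mem_set Al)).
Qed.

Lemma vN_selfadjoint_limit (y : nat -> vN_elt A) l (c : R) :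
  (forall n x, `|val (y n) x - val l x| <= (c / 2 ^+ n)%:C * `|x|) ->
  (forall n, vN_star (y n) = y n) -> vN_star l = l.
Proof.
move=> yl ys; apply: vN_starE => x z.
have yx x' : val (y n) x' @[n --> \oo] --> val l x'.
  exact: cvg_of_geometric (yl^~ x').
have := @cvg_lipschitz _ _ R[i]^o (inner x) `|x| _ _ (normr_ge0 x) _ (yx z).
have := @cvg_lipschitz _ _ R[i]^o (inner^~ z) `|z| _ _ (normr_ge0 z) _ (yx x).
have -> : (fun n => inner (val (y n) x) z) = (fun n => inner x (val (y n) z)).
  by apply/funext => n; rewrite vN_starP ys.
move=> lx lz; apply: (cvg_unique (@norm_hausdorff _ R[i]^o) (lx _) (lz _)).
  by move=> a b; rewrite -innerNl -innerDl mulrC cauchy_schwarz.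
by move=> a b; rewrite -innerNr -innerDr cauchy_schwarz.
Qed.

Definition vN_half_ball a := forall x, `|val a x| <= 2^-1 * `|x|.

(** If y satisfies this equation then (1 - y) (1 - y) = 1 - a. On the ball of
    radius 1/2 the map y |-> (a + y y) / 2 is a contraction of ratio 1/2, since
    p p - q q = p (p - q) + (p - q) q. All iterates are polynomials in a, so the
    limit inherits self-adjointness and commutation properties. *)
Lemma vN_sqrt_fixpoint a : vN_half_ball a -> vN_star a = a ->
  exists y, [/\ y = 2^-1 *: (a + vN_mul y y), vN_star y = y
    & forall c, vN_mul c a = vN_mul a c -> vN_mul c y = vN_mul y c].
Proof.
move=> aball asa.
pose step y := 2^-1 *: (a + vN_mul y y).
pose y n := iter n step 0.
have yS n : y n.+1 = step (y n) by [].
have half0 : 0 <= 2^-1 :> R[i] by rewrite invr_ge0.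
have yball n : vN_half_ball (y n).
  elim: n => [|n IH] x; first by rewrite vN_E normr0 mulr_ge0.
  rewrite yS !vN_E normrZ ger0_norm// ler_wpM2l//.
  have -> : `|x| = 2^-1 * `|x| + 2^-1 * `|x| by field.
  rewrite (le_trans (ler_normD _ _))// lerD// (le_trans (IH _))//.
  rewrite ler_wpM2l// (le_trans (IH _))// ler_piMl// invf_le1//.
  by rewrite ler1n.
have ystep n x : `|val (y n.+1) x - val (y n) x| <= (1 / 2 ^+ n)%:C * `|x|.
  elim: n x => [|n IH] x.
    rewrite yS /step (_ : y 0%N = 0)// !vN_E subr0 addr0 normrZ ger0_norm//.
    rewrite expr0 divr1 mul1r.
    rewrite (le_trans (ler_wpM2l half0 (aball x)))// mulrA ler_piMl//.
    by rewrite -invfM invf_le1 -?natrM ?ltr0n ?ler1n.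
  rewrite 2!yS /step !vN_E.
  set p := val (y n.+1); set q := val (y n); pose t : R[i] := (1 / 2 ^+ n)%:C.
  have t0 : 0 <= t by rewrite ler0c divr_ge0 ?exprn_ge0.
  have -> : 2^-1 *: (val a x + p (p x)) - 2^-1 *: (val a x + q (q x)) =
      2^-1 *: (p (p x - q x) + (p (q x) - q (q x))).
    have -> : p (p x - q x) = p (p x) - p (q x).
      by rewrite /p vN_D vN_N.
    module.
  have -> : (1 / 2 ^+ n.+1)%:C = 2^-1 * t.
    rewrite /t exprS invfM mulrCA (rmorphM (real_complex R)) /= fmorphV.
    by rewrite rmorph_nat.
  rewrite normrZ ger0_norm// -mulrA ler_wpM2l//.
  have -> : t * `|x| = 2^-1 * (t * `|x|) + t * (2^-1 * `|x|).
    rewrite [t * (2^-1 * _)]mulrCA -mulrDl.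
    have -> : 2^-1 + 2^-1 = 1 :> R[i] by field.
    by rewrite mul1r.
  rewrite (le_trans (ler_normD _ _))// lerD//.
    by rewrite (le_trans (yball _ _))// ler_wpM2l.
  by rewrite (le_trans (IH _))// ler_wpM2l// yball.
have [l yl] := vN_geometric_cauchy ler01 ystep.
have ys n : vN_star (y n) = y n.
  elim: n => [|n IH]; first exact: vN_star0.
  by rewrite yS /step vN_starZ vN_starD vN_starM asa IH fmorphV rmorph_nat.
have yx x : val (y n) x @[n --> \oo] --> val l x.
  exact: cvg_of_geometric (yl^~ x).
have yyx x : val (y n) (val (y n) x) @[n --> \oo] --> val l (val l x).
  have -> : (fun n => val (y n) (val (y n) x)) =
      (fun n => val (y n) (val (y n) x - val l x) + val (y n) (val l x)).
    by apply/funext => n; rewrite -vN_D subrK.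
  rewrite -[X in _ --> X]add0r; apply: cvgD; last exact: yx.
  apply: (cvg_of_geometric (c := 1 * 2) (t := `|x|)) => // n; rewrite subr0.
  rewrite (le_trans (yball _ _))// (le_trans _ (yl n x))//.
  by rewrite ler_piMl// invf_le1// ler1n.
exists l; split.
- apply: vN_ext => x; rewrite !vN_E.
  have := yx x; rewrite -cvg_shiftS.
  have -> : (fun n => val (y n.+1) x) =
      (fun n => 2^-1 *: (val a x + val (y n) (val (y n) x))).
    by apply/funext => n; rewrite yS /step !vN_E.
  move=> /(cvg_unique (@norm_hausdorff _ _)); apply.
  by apply: cvgZr; apply: cvgD; [exact: cvg_cst|exact: yyx].
- exact: vN_selfadjoint_limit yl ys.
- move=> c ca; apply: vN_ext => x; rewrite !vN_E.
  have yc n : vN_mul c (y n) = vN_mul (y n) c.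
    elim: n => [|n IH].
      by rewrite (_ : y 0%N = 0)//; apply: vN_ext => z; rewrite !vN_E vN_0.
    rewrite yS /step vN_mulZl vN_mulZr vN_mulDl vN_mulDr ca.
    by rewrite vN_mulA IH -vN_mulA IH vN_mulA.
  have := bounded_linear_cvg (vN_bounded (vN_valP c)) (yx x).
  have -> : (fun n => val c (val (y n) x)) = (fun n => val (y n) (val c x)).
    by apply/funext => n; rewrite -!vN_mulE yc.
  by move=> /(cvg_unique (@norm_hausdorff _ _)); apply; exact: yx.
Qed.

Lemma vN_contraction_sqrt a : vN_half_ball a -> vN_star a = a ->
  exists r, [/\ vN_mul r r = vN_one A - a, vN_star r = r
    & forall c, vN_mul c a = vN_mul a c -> vN_mul c r = vN_mul r c].
Proof.
move=> aball asa; have [y [yE ys yc]] := vN_sqrt_fixpoint aball asa.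
have mul1 c : vN_mul (vN_one A) c = c by exact: vN_ext.
have mulr1 c : vN_mul c (vN_one A) = c by exact: vN_ext.
have mulN c d : vN_mul c (- d) = - vN_mul c d.
  by rewrite -scaleN1r vN_mulZr scaleN1r.
have mulNl c d : vN_mul (- c) d = - vN_mul c d.
  by rewrite -scaleN1r vN_mulZl scaleN1r.
exists (vN_one A - y); split.
- rewrite vN_mulDl !vN_mulDr !mulNl !mulN mul1 mul1 mulr1.
  have : y + y = a + vN_mul y y.
    by rewrite {1 2}yE -scaler_halves.
  move=> yE2; have -> : a = y + y - vN_mul y y by rewrite yE2 addrK.
  module.
- rewrite vN_starD -scaleN1r vN_starZ ys rmorphN rmorph1.
  by congr (_ + _); exact: vN_starE.
- by move=> c ca; rewrite vN_mulDl vN_mulDr mulN mulNl mul1 mulr1 yc.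
Qed.

Lemma unitary_of_commuting_squares h r (j : R[i]) :
  vN_star h = h -> vN_star r = r -> vN_mul h r = vN_mul r h ->
  vN_mul h h + vN_mul r r = vN_one A -> (j^*)%R = - j -> j * j = -1 ->
  tripotent (h + j *: r).
Proof.
move=> hs rs hr hr1 cj jj; apply: unitary_tripotent.
rewrite vN_starD vN_starZ hs rs cj.
rewrite !(vN_mulDl, vN_mulDr, vN_mulZl, vN_mulZr) hr scalerA mulrN jj opprK.
by rewrite -hr1; module.
Qed.

Lemma vN_selfadjoint_unitaries h : vN_star h = h -> vN_half_ball h ->
  exists u v, [/\ tripotent u, tripotent v & h = 2^-1 *: (u + v)].
Proof.
move=> hs hball.
have half0 : 0 <= 2^-1 :> R[i] by rewrite invr_ge0.
have hhball : vN_half_ball (vN_mul h h).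
  move=> x; rewrite vN_E (le_trans (hball _))// ler_wpM2l//.
  by rewrite (le_trans (hball _))// ler_piMl// invf_le1// ler1n.
have hhs : vN_star (vN_mul h h) = vN_mul h h by rewrite vN_starM hs.
have [r [rr rs rc]] := vN_contraction_sqrt hhball hhs.
have hr : vN_mul h r = vN_mul r h by apply: rc; rewrite vN_mulA.
have hr1 : vN_mul h h + vN_mul r r = vN_one A by rewrite rr addrC subrK.
have [j [cj jj _]] := imaginary_unit R.
exists (h + j *: r), (h + - j *: r); split.
- exact: unitary_of_commuting_squares.
- apply: unitary_of_commuting_squares => //; last by rewrite mulrNN.
  by rewrite rmorphN /= cj.
- have -> : h + j *: r + (h + - j *: r) = 2 *: h by module.
  by rewrite scalerA mulVf ?scale1r// pnatr_eq0.
Qed.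

(** The real and imaginary parts of an element are self-adjoint, and a multiple
    of each lies in the ball of radius 1/2. *)
Lemma vN_spanned_by_tripotents : spanned_by_tripotents (vN_elt A).
Proof.
move=> P PD PZ Ptri.
have Psa a : vN_star a = a -> P a.
  move=> asa; have [c c0 ac] := bounded_linear_nneg (vN_bounded (vN_valP a)).
  pose t : R[i] := ((c + 1) * 2)%:C.
  have t0 : 0 < t by rewrite ltcR mulr_gt0// ltr_wpDl.
  have tJ : ((t^-1)^*)%R = t^-1 by rewrite geC0_conj// invr_ge0 ltW.
  have [||u [v [u3 v3 uv]]] := @vN_selfadjoint_unitaries (t^-1 *: a).
  - by rewrite vN_starZ asa tJ.
  - move=> x; rewrite vN_E normrZ ger0_norm; last by rewrite invr_ge0 ltW.
    rewrite ler_pdivrMl// (le_trans (ac x))// mulrA.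
    rewrite ler_wpM2r// /t (rmorphM (real_complex R)) /= rmorph_nat.
    by rewrite mulfK ?pnatr_eq0// lecR lerDl.
  - have -> : a = t *: (2^-1 *: (u + v)).
      by rewrite -uv scalerA divff ?scale1r ?gt_eqF.
    by apply/PZ/PZ/PD; exact: Ptri.
move=> a; have [j [cj jj _]] := imaginary_unit R.
pose b := a + vN_star a; pose c := j *: (a - vN_star a).
have -> : a = 2^-1 *: (b + - j *: c).
  rewrite /c scalerA mulNr jj opprK scale1r addrACA subrr addr0.
  by rewrite scalerDr -scaler_halves.
apply/PZ/PD; first by apply: (Psa); rewrite vN_starD vN_starK addrC.
apply/PZ/Psa; rewrite /c vN_starZ vN_starD -scaleN1r vN_starZ vN_starK.
by rewrite cj rmorphN rmorph1; module.
Qed.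

End SquareRoot.

Theorem corollary3p6 (R : realType) (H : hilbertType R)
  (A : vonNeumannAlgebra H) (F : jbTripleType R) (T : vN_elt A -> F) :
  two_local_triple_homomorphism T -> linear T /\ triple_homomorphism T.
Proof.
move=> T2; have TP : triple_homomorphism T.
  apply: two_local_is_triple_homomorphism T2; first exact: vN_triple_form.
  exact: vN_spanned_by_tripotents.
by split=> //; case: TP.
Qed.
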